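(* Let $M$ be an infinite, compact and locally connected metric space. Let $\varPhi$ be a continuous action of a finitely generated group $G$ on $M$ by homeomorphisms. If $\varPhi$ is $CW$-expansive, then $\varPhi$ has positive geometric entropy.
   Context: For $g\in G$ let $\phi_g=\varPhi(g,\cdot):M\to M$ be the homeomorphism induced by $g$. The action is regarded as a finitely generated pseudo-group on $M$ whose elements are the homeomorphisms $\phi_g$ (with domain $M$). $CW$-expansive: there is $\delta>0$ such that for every compact connected set $C\subset M$ with more than one point there is $g\in G$ with $\mathrm{diam}(\phi_g(C))>\delta$. Geometric entropy: let $K$ be a finite generating set of $G$; for $g\in G$ let $\#g$ be the minimal number of elements of $K\cup K^{-1}$ whose product is $g$. Points $x,y\in M$ are $n$-$\varepsilon$-$K$-separated if there is $g\in G$ with $\#g\le n$ and $d(\phi_g(x),\phi_g(y))>\varepsilon$. Let $S(n,\varepsilon,K)$ be the maximal cardinality of a subset of $M$ whose distinct points are pairwise $n$-$\varepsilon$-$K$-separated, and $h(\varPhi,K)=\lim_{\varepsilon\to0}\limsup_{n\to\infty}\frac1n\log S(n,\varepsilon,K)$. Positivity of $h(\varPhi,K)$ does not depend on the finite generating set $K$; $\varPhi$ has positive geometric entropy if $h(\varPhi,K)>0$. *)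

(* Defs.v *)
From mathcomp Require Import all_boot all_order all_algebra finmap.
From mathcomp Require Import all_classical all_reals all_analysis.
Set Implicit Arguments.
Unset Strict Implicit.
Unset Printing Implicit Defensive.
Import Order.TTheory GRing.Theory Num.Theory.
Import numFieldNormedType.Exports.
Local Open Scope classical_set_scope.
Local Open Scope ring_scope.

Section Words.
Variable G : groupType.
Implicit Types (K : {fset G}) (s : seq G) (g : G) (n : nat).

Definition word_over K s :=
  {subset s <= (K `|` [fset (k^-1)%g | k in K])%fset}.

Definition generating_set K :=
  forall g, exists2 s, word_over K s & (\prod_(k <- s) k)%g = g.

Definition finitely_generated := exists K, generating_set K.

Definition word_of_size K g n :=
  exists s, [/\ word_over K s, size s = n & (\prod_(k <- s) k)%g = g].

(* The default value 0 is only reached by elements g that are not a product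
   of elements of K and K^-1; there are none when K is a generating set. *)
Definition word_length K g : nat :=
  xget 0%N [set n | word_of_size K g n /\
                    forall m, word_of_size K g m -> (n <= m)%N].

End Words.

Definition locally_connected (T : topologicalType) :=
  forall (x : T) (U : set T), nbhs x U ->
    exists V : set T, [/\ open V, connected V, V x & V `<=` U].

Definition diam (R : realType) (M : metricType R) (A : set M) : \bar R :=
  ereal_sup [set (mdist p.1 p.2)%:E | p in A `*` A].

Section Action.
Variables (R : realType) (G : groupType) (M : metricType R).
Implicit Types (phi : G -> M -> M) (K : {fset G}) (e : R) (n : nat).

(* G carries the discrete topology, so that joint continuity on G * M amounts
   to the continuity of every phi g; each phi g is then a homeomorphism, with
   inverse phi g^-1. *)
Definition continuous_action phi :=
  [/\ forall x, phi 1%g x = x,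
      forall g h x, phi (g * h)%g x = phi g (phi h x)
    & forall g, continuous (phi g)].

Definition cw_expansive phi :=
  exists2 delta : R, 0 < delta &
    forall C : set M, compact C -> connected C ->
      (exists x y, [/\ C x, C y & x <> y]) ->
      exists g : G, (delta%:E < diam (phi g @` C))%E.

Definition separated_points phi K n e (x y : M) :=
  exists2 g : G, (word_length K g <= n)%N & e < mdist (phi g x) (phi g y).

Definition separated_fset phi K n e (A : {fset M}) :=
  {in A &, forall x y, x <> y -> separated_points phi K n e x y}.

(* Finite sets suffice: if there were an infinite separated set, its finite
   subsets would give the value +oo.  When M is compact and every phi g is
   continuous, the supremum is finite, hence a maximum. *)
Definition max_separated phi K n e : \bar R :=
  ereal_sup [set (#|` A|%fset%:R)%:E | A in separated_fset phi K n e].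

Definition geometric_entropy phi K : \bar R :=
  lim (limn_esup (fun n => ((n%:R^-1)%:E * lne (max_separated phi K n e))%E)
         @[e --> 0^'+]).

(* Positivity does not depend on the finite generating set; the definition is
   meaningful for finitely generated G only. *)
Definition positive_geometric_entropy phi :=
  forall K, generating_set K -> (0 < geometric_entropy phi K)%E.

End Action.

(* Main.v *)
Require Import Defs.
From mathcomp Require Import all_boot all_order all_algebra.
From mathcomp Require Import all_classical all_reals all_analysis.
From mathcomp Require Import finmap lra.
Set Implicit Arguments.
Unset Strict Implicit.
Unset Printing Implicit Defensive.
Import Order.TTheory GRing.Theory Num.Theory.
Import numFieldNormedType.Exports metricType_numDomainType.
Local Open Scope classical_set_scope.
Local Open Scope ring_scope.

(** A continuum here is a closed connected subset of the compact space [M].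
    Let [delta] be an expansivity constant and call a connected set wide when
    it has two points at distance at least [delta / 3].

    Every wide set is stretched beyond [delta] by some [g] whose word length is
    at most a bound [N] that does not depend on the set
    ([cw_expansive_uniform]): otherwise wide sets that resist all words of
    length [n] would accumulate, as [n] grows, on a nondegenerate continuum
    that no element of [G] stretches beyond [delta].  In turn, a continuum with
    two points [x], [y] at distance more than [delta] contains two wide
    continua, one within [delta / 3] of [x] and one within [delta / 3] of [y]
    ([boundary_bumping]); these are more than [delta / 3] apart.  Stretching
    and splitting alternately yields a binary tree of wide continua.  After
    [k] rounds it has [2 ^ k] leaves, and points pulled back from distinct
    leaves are separated at scale [delta / 3] by a word of length at most
    [k * N] ([separated_doubling]).  So the entropy is at least [ln 2 / N],
    provided that one nondegenerate continuum exists to start from, which is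
    where local connectedness and the infinity of [M] are used
    ([locally_connected_nontrivial]).

    Both accumulation arguments rest on one notion of limit of a sequence of
    sets, along an ultrafilter on [nat] finer than the eventual filter: such a
    limit always exists, and no metric or topology on the space of closed
    subsets is involved.  The limit is connected as soon as the sets of the
    sequence are connected up to gaps of size tending to [0]
    ([ultralimit_connected]).  Allowing gaps makes boundary bumping a case of
    the same lemma: the part of a continuum reachable from [x] by small jumps
    inside a ball has to come close to the boundary of the ball, and the limit
    of these parts for smaller and smaller jumps is a continuum that reaches
    the boundary. *)

(** * Sets connected up to small gaps *)

Section Chains.
Context {R : realType} {M : metricType R}.
Implicit Types (A F : set M) (e r : R) (x y z : M).

Lemma near_mdist_lt x e : 0 < e -> \forall y \near x, mdist x y < e.
Proof.
move=> e0; have := nbhsx_ballx x e e0.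
by apply: filterS => y; rewrite ballEmdist.
Qed.

Lemma mdist_cball_closed x r : closed [set y | mdist x y <= r].
Proof.
move=> y cy; rewrite /= leNgt; apply/negP => ry.
have e0 : 0 < mdist x y - r by rewrite subr_gt0.
have [z [/= xz yz]] := cy _ (near_mdist_lt y e0).
have := metric_triangle x z y; rewrite leNgt => /negP; apply.
by rewrite -ltrBrDl (lt_le_trans _ (lerB (lexx _) xz))// metric_sym.
Qed.

(** Connectedness at scale [e], in terms of splittings instead of finite
    chains: no partition of [A] into two nonempty parts leaves a gap of size
    [e] between them. *)
Definition chained e A := forall P : set M,
  A `&` P !=set0 -> A `\` P !=set0 ->
  exists p q, [/\ (A `&` P) p, (A `\` P) q & mdist p q < e].

Lemma connected_chained e A : 0 < e -> connected A -> chained e A.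
Proof.
move=> e0 Ac P AP [q [Aq nPq]]; apply: contrapT => far.
have Pq : (A `&` P) q; last by case: Pq.
have ball_in p : (ball p e)° p by exact: nbhsx_ballx.
rewrite (Ac (A `&` P) AP)//.
- exists (\bigcup_(p in A `&` P) (ball p e)°).
    by apply: bigcup_open => p _; exact: open_interior.
  apply/seteqP; split=> [p [Ap Pp]|z [Az [p APp /interior_subset pz]]].
    by split=> //; exists p.
  split=> //; apply: contrapT => nPz; apply: far; exists p, z; split=> //.
  by move: pz; rewrite ballEmdist.
- exists (~` \bigcup_(z in A `\` P) (ball z e)°).
    by apply/open_closedC/bigcup_open => z _; exact: open_interior.
  apply/seteqP; split=> [p [Ap Pp]|z [Az nz]].
    split=> // -[z Az /interior_subset]; rewrite ballEmdist/= metric_sym => zp.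
    by apply: far; exists p, z.
  split=> //; apply: contrapT => nPz; apply: nz; exists z => //; exact: ball_in.
Qed.

Inductive chain_component e A x : M -> Prop :=
| chain_start : chain_component e A x x
| chain_step p q : chain_component e A x p -> A q -> mdist p q < e ->
    chain_component e A x q.

Lemma chain_component_sub e A x : A x -> chain_component e A x `<=` A.
Proof. by move=> Ax z; case. Qed.

(** A splitting without a short jump is constant along each chain, hence
    agrees everywhere with its value at the start [x]. *)
Lemma chain_component_chained e A x : A x -> chained e (chain_component e A x).
Proof.
move=> Ax P [a [Fa Pa]] [b [Fb nPb]]; apply: contrapT => far.
have [Px|nPx] := pselect (P x).
  apply: nPb; elim: Fb => // p q Fp Pp Aq pq; apply: contrapT => nPq.
  by apply: far; exists p, q; split=> //; split=> //; exact: chain_step Fp _ _.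
suff : ~ P a by [].
elim: Fa => // p q Fp nPp Aq pq Pq.
apply: far; exists q, p; rewrite metric_sym; split=> //; split=> //.
exact: chain_step Fp _ _.
Qed.

(** Boundary bumping with jumps: if the chains from [x] inside the ball all
    stayed at depth more than [e] below the boundary, no jump of size [e] in
    [A] could leave the ball, so the chain component would be all of [A],
    including [y], which is too far from [x]. *)
Lemma chain_component_reaches e r A x y : 0 < e -> connected A ->
  A x -> A y -> r <= mdist x y ->
  exists2 z, chain_component e (A `&` [set z | mdist x z <= r]) x z &
    r - e <= mdist x z.
Proof.
move=> e0 Ac Ax Ay rxy; apply: contrapT => near_x.
set F := chain_component _ _ _ in near_x.
have F_near z : F z -> mdist x z < r - e.
  by move=> Fz; rewrite ltNge; apply/negP => rz; apply: near_x; exists z.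
have Fx : F x by exact: chain_start.
have nFy : ~ F y.
  move=> /F_near; rewrite ltNge (le_trans _ rxy)// lerBlDr lerDl; exact: ltW.
have [| |p [q [[Ap Fp] [Aq nFq] pq]]] := connected_chained e0 Ac (P := F).
- by exists x.
- by exists y.
apply: nFq; apply: (chain_step Fp _ pq); split=> //=.
rewrite (le_trans (metric_triangle x p q))// -[leRHS](subrK e) lerD// ltW//.
exact: F_near.
Qed.

End Chains.

(** * Limits of sequences of sets along an ultrafilter *)

Section Ultralimit.
Context {R : realType} {M : metricType R}.
Implicit Types (F : nat -> set M) (p q : nat -> M) (e r : R) (x y z : M).

(** Kuratowski limit along [U]; as [U] is an ultrafilter in all uses, the lower
    and the upper limit coincide. *)
Definition ultralimit (U : set_system nat) F : set M :=
  [set x | forall V, nbhs x V -> U [set n | F n `&` V !=set0]].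

Lemma ultralimit_closed U F : closed (ultralimit U F).
Proof.
move=> x Lx V /nbhs_interior Vx; have [z [Lz Vz]] := Lx _ Vx.
exact: Lz.
Qed.

Context (U : set_system nat) {UU : UltraFilter U}.

Lemma ultralimit_cvg F p x : (\forall n \near U, F n (p n)) -> p @ U --> x ->
  ultralimit U F x.
Proof.
move=> Fp px V /px Vp; near=> n; exists (p n); split.
  by near: n.
by near: n.
Unshelve. all: by end_near. Qed.

Lemma ultralimit_sub F A : closed A -> (\forall n \near U, F n `<=` A) ->
  ultralimit U F `<=` A.
Proof.
move=> Acl FA x Lx; apply: Acl => V /Lx UV.
have [n [FnA [z [Fz Vz]]]] := filter_ex (filterI FA UV).
by exists z; split=> //; exact: FnA.
Qed.

(** [p @ U] need not be treated as an ultrafilter: [U] itself decides, for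
    each neighborhood of a cluster point, on which side [p] eventually is. *)
Lemma compact_ultra_cvg p : compact [set: M] -> exists x, p @ U --> x.
Proof.
move=> /(_ (p @ U) _ filterT)[x [_ px]]; exists x => V Vx.
have [//|nV] := in_ultra_setVsetC (p @^-1` V) UU.
by have [z []] := px (~` V) V nV Vx.
Qed.

Lemma cvg_mdist_ge p q x y r : p @ U --> x -> q @ U --> y ->
  (\forall n \near U, r <= mdist (p n) (q n)) -> r <= mdist x y.
Proof.
move=> px qy rpq; apply/ler_addgt0Pr => e e0; have e2 := divr_gt0 e0 (ltr0n R 2).
have Up : \forall n \near U, mdist x (p n) < e / 2 by exact: cvgr_dist_lt.
have Uq : \forall n \near U, mdist y (q n) < e / 2 by exact: cvgr_dist_lt.
have [n [[pn qn] rn]] := filter_ex (filterI (filterI Up Uq) rpq).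
rewrite (le_trans rn)// (le_trans (metric_triangle (p n) x (q n)))//.
rewrite [in leRHS](splitr e) addrCA lerD//; first by rewrite metric_sym ltW.
by rewrite (le_trans (metric_triangle x y (q n)))// lerD// ltW.
Qed.

Lemma ultralimit_mdist_le (f : M -> M) F r x y : continuous f ->
  (\forall n \near U, forall u v, F n u -> F n v -> mdist (f u) (f v) <= r) ->
  ultralimit U F x -> ultralimit U F y -> mdist (f x) (f y) <= r.
Proof.
move=> fc Fr Lx Ly; apply/ler_addgt0Pr => e e0.
have e2 := divr_gt0 e0 (ltr0n R 2).
have Ux := Lx _ (fc x _ (near_mdist_lt (f x) e2)).
have Uy := Ly _ (fc y _ (near_mdist_lt (f y) e2)).
have [n [[[u [Fu xu]] [v [Fv yv]]] rn]] := filter_ex (filterI (filterI Ux Uy) Fr).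
rewrite (le_trans (metric_triangle (f x) (f u) (f y)))//.
rewrite [in leRHS](splitr e) addrCA lerD//; first exact: ltW.
rewrite (le_trans (metric_triangle (f u) (f v) (f y)))// lerD//; first exact: rn.
by rewrite metric_sym ltW.
Qed.

(** If the limit split into disjoint closed parts, an open set [P] containing
    one of them with closure avoiding the other would split almost all [F n],
    so that [F n] has points [p n] in [P] and [q n] outside of [P] whose
    distance tends to [0].  Their common limit is in the limit set and on the
    boundary of [P], where there is no point of either part. *)
Lemma ultralimit_connected F (e : nat -> R) : compact [set: M] ->
  (forall r, 0 < r -> \forall n \near U, e n < r) ->
  (\forall n \near U, chained (e n) (F n)) -> connected (ultralimit U F).
Proof.
move=> Mc e0 Fch; apply/connectedP => E [E0 LE [E01 E10]].
have Ecl b : closed (E b).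
  move=> x Ex; have : ultralimit U F x.
    apply: (ultralimit_closed (U := U)) => V /Ex[z [Ez Vz]]; exists z; split=> //.
    by rewrite LE; case: b Ez {Ex}; [right|left].
  rewrite LE; case: b Ex => Ex [] // Ez; exfalso.
    by have : (E false `&` closure (E true)) x by []; rewrite E10.
  by have : (closure (E false) `&` E true) x by []; rewrite E01.
have nbhsE0 : set_nbhs (E false) (~` E true).
  apply/set_nbhsP; exists (~` E true); split=> //; first exact/closed_openC.
  by move=> x Ex Ey; have : set0 x by rewrite -E01; split=> //; exact: subset_closure.
have [W W0 WE] := compact_normal (@metric_hausdorff _ M) Mc (Ecl false) nbhsE0.
have /set_nbhsP[P [oP EP PW]] := W0.
have clP : closure P `<=` ~` E true by apply: subset_trans WE; exact: closureS.
have [a Ea] := E0 false; have [b Eb] := E0 true.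
have Ua : \forall n \near U, F n `&` P !=set0.
  have : ultralimit U F a by rewrite LE; left.
  by apply; apply: open_nbhs_nbhs; split=> //; exact: EP.
have Ub : \forall n \near U, F n `\` P !=set0.
  have : ultralimit U F b by rewrite LE; right.
  move=> /(_ (~` closure P)) UPb; apply: filterS (UPb _).
    by move=> n [z [Fz Pz]]; exists z; split=> // /subset_closure.
  apply: open_nbhs_nbhs; split; first exact/closed_openC/closed_closure.
  by move=> /clP.
have /choice[pq Upq] : forall n, exists pq : M * M, chained (e n) (F n) ->
   F n `&` P !=set0 -> F n `\` P !=set0 ->
   [/\ (F n `&` P) pq.1, (F n `\` P) pq.2 & mdist pq.1 pq.2 < e n].
  move=> n; have [[c p0 q0]|no] := pselect
    [/\ chained (e n) (F n), F n `&` P !=set0 & F n `\` P !=set0].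
    by have [p [q ?]] := c P p0 q0; exists (p, q).
  by exists (a, a) => c p0 q0; exfalso; apply: no.
pose p n := (pq n).1; pose q n := (pq n).2.
have {Upq}Upq : \forall n \near U,
    [/\ (F n `&` P) (p n), (F n `\` P) (q n) & mdist (p n) (q n) < e n].
  by near=> n; apply: Upq; near: n.
have [x px] := compact_ultra_cvg p Mc.
have Lx : ultralimit U F x.
  by apply: ultralimit_cvg px; apply: filterS Upq => n [[]].
have clx : closure P x.
  move=> V /px UV.
  have {}UV : U (p @^-1` V) by exact: UV.
  have [n [Vn [[_ Pp] _ _]]] := filter_ex (filterI UV Upq).
  by exists (p n).
have nPx : ~ P x.
  move=> Px; have : nbhs x P by exact: open_nbhs_nbhs.
  rewrite -nbhs_ballE => -[r /= r0 rP]; have r2 := divr_gt0 r0 (ltr0n R 2).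
  have Up : \forall n \near U, mdist x (p n) < r / 2 by exact: cvgr_dist_lt.
  have [n [[pn en] [_ [_ nPq] pqn]]] :=
    filter_ex (filterI (filterI Up (e0 _ r2)) Upq).
  apply: nPq; apply: rP; rewrite ballEmdist/=.
  rewrite (le_lt_trans (metric_triangle x (p n) (q n)))// (splitr r) ltrD//.
  exact: lt_trans en.
move: Lx; rewrite LE => -[/EP//|]; exact: clP.
Unshelve. all: by end_near. Qed.

End Ultralimit.

(** * Continua *)

Lemma ultra_eventually :
  exists2 U : set_system nat, UltraFilter U & \oo `<=` U.
Proof. by have [U [UU ooU]] := ultraFilterLemma eventually_filter; exists U. Qed.

Section Continua.
Context {R : realType} {M : metricType R}.
Implicit Types (A C D : set M) (x y : M) (r delta gamma : R).

(** [D] is the limit of the chain components of [x] in the part of [C] within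
    [r] of [x], for jumps of size [1 / (n + 1)]. *)
Lemma boundary_bumping C x y r : compact [set: M] -> closed C -> connected C ->
  C x -> C y -> 0 <= r <= mdist x y ->
  exists D, [/\ closed D, connected D, D `<=` C `&` [set z | mdist x z <= r],
                D x & exists2 z, D z & r <= mdist x z].
Proof.
move=> Mc Ccl Cc Cx Cy /andP[r0 rxy].
have [U UU ooU] := ultra_eventually.
pose e n : R := n.+1%:R^-1.
have e_gt0 n : 0 < e n by rewrite invr_gt0.
have e_lim s : 0 < s -> \forall n \near U, e n < s.
  by move=> s0; apply: ooU; exact: (near_infty_natSinv_lt (PosNum s0)).
pose B := C `&` [set z | mdist x z <= r].
have Bx : B x by split=> //=; rewrite mdistxx.
have Bcl : closed B by apply: closedI => //; exact: mdist_cball_closed.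
pose F n := chain_component (e n) B x.
have /choice[z zP] : forall n, exists z, F n z /\ r - e n <= mdist x z.
  by move=> n; have [z] := chain_component_reaches (e_gt0 n) Cc Cx Cy rxy; exists z.
have [z0 zz0] := compact_ultra_cvg z Mc.
exists (ultralimit U F); split.
- exact: ultralimit_closed.
- apply: ultralimit_connected e_lim _ => //; apply: nearW => n.
  exact: chain_component_chained.
- by apply: ultralimit_sub => //; apply: nearW => n; exact: chain_component_sub.
- apply: (@ultralimit_cvg _ _ _ _ _ (cst x)); last exact: cvg_cst.
  by apply: nearW => n; exact: chain_start.
- exists z0; first by apply: ultralimit_cvg zz0; apply: nearW => n; case: (zP n).
  apply/ler_addgt0Pr => s s0; rewrite -lerBlDr.
  apply: (cvg_mdist_ge (p := cst x) (q := z)) zz0 _; first exact: cvg_cst.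
  apply: filterS (e_lim s s0) => n es.
  by rewrite (le_trans _ (zP n).2)// lerD2l lerN2 ltW.
Qed.

Lemma diam_gtP A delta : (delta%:E < diam A)%E ->
  exists x y, [/\ A x, A y & delta < mdist x y].
Proof.
by move=> /ereal_sup_gt[_ [[x y] [/= Ax Ay] <-]]; rewrite lte_fin; exists x, y.
Qed.

(** Otherwise connected sets have at most one point, and local connectedness
    makes all points isolated; but in an infinite compact space the cofinite
    filter has a cluster point, which cannot be isolated. *)
Lemma locally_connected_nontrivial : compact [set: M] ->
  infinite_set [set: M] -> locally_connected M ->
  exists C : set M, [/\ closed C, connected C & exists x y, [/\ C x, C y & x <> y]].
Proof.
move=> Mc Minf lc; apply: contrapT => triv.
have open1 x : open [set x].
  have [V [oV Vc Vx _]] := lc x setT filterT.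
  suff -> : [set x] = V by [].
  apply/seteqP; split=> [z ->//|z Vz]; apply: contrapT => zx; apply: triv.
  exists (closure V); split.
  - exact: closed_closure.
  - exact: connected_closure.
  - by exists z, x; split=> //; exact: subset_closure.
have cofin : ProperFilter [set A : set M | finite_set (~` A)].
  split; first by rewrite /= setC0.
  split=> [|A B|A B AB] /=; first by rewrite setCT.
    by rewrite setCI finite_setU.
  by apply: sub_finite_set; exact: subsetC.
have [|x [_ clx]] := Mc _ cofin; first by rewrite /= setCT.
have [| |z []//] := clx (~` [set x]) [set x].
  by rewrite /= setCK.
exact: open_nbhs_nbhs.
Qed.

End Continua.

(** * Word length *)

Section WordLength.
Context {G : groupType}.
Implicit Types (K : {fset G}) (g h : G).

Lemma word_of_size_length K g : generating_set K ->
  word_of_size K g (word_length K g).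
Proof.
move=> Kgen; suff [] : [set n | word_of_size K g n /\
    forall m, word_of_size K g m -> (n <= m)%N] (word_length K g) by [].
apply: xgetPex; have [s Ks sg] := Kgen g.
have exn : exists n, `[< word_of_size K g n >].
  by exists (size s); apply/asboolP; exists s.
case: (ex_minnP exn) => n /asboolP Kn nmin; exists n; split=> // m Km.
by apply: nmin; exact/asboolP.
Qed.

Lemma word_length_le K g n : word_of_size K g n -> (word_length K g <= n)%N.
Proof.
by rewrite /word_length; case: xgetP => [m _ [_ mmin]|_ //]; exact: mmin.
Qed.

Lemma word_length_mul K g h : generating_set K ->
  (word_length K (g * h)%g <= word_length K g + word_length K h)%N.
Proof.
move=> Kgen; have [s [Ks <- sg]] := word_of_size_length g Kgen.
have [t [Kt <- th]] := word_of_size_length h Kgen.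
apply: word_length_le; exists (s ++ t); split.
- by move=> k; rewrite mem_cat => /orP[/Ks|/Kt].
- exact: size_cat.
- by rewrite big_cat/= sg th.
Qed.

End WordLength.

(** * Uniform stretching and separated sets *)

Section Action.
Context {R : realType} {G : groupType} {M : metricType R}.
Implicit Types (phi : G -> M -> M) (K : {fset G}) (C : set M) (delta gamma e : R).

Lemma continuum_image (f : M -> M) C : compact [set: M] -> continuous f ->
  closed C -> connected C -> closed (f @` C) /\ connected (f @` C).
Proof.
move=> Mc fc Ccl Cc; split.
  apply: compact_closed; first exact: metric_hausdorff.
  apply: continuous_compact; first exact: continuous_subspaceT.
  exact: subclosed_compact Ccl Mc (@subsetT _ _).
by apply: connected_continuous_connected => //; exact: continuous_subspaceT.
Qed.

(** A counterexample [C n] for each bound [n.+1] would have as ultralimit a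
    continuum with two points at distance at least [gamma]; each [g] is
    eventually within the bound, so no [g] would stretch this limit beyond
    [delta]. *)
Lemma cw_expansive_uniform phi K delta gamma : compact [set: M] ->
  (forall g, continuous (phi g)) -> 0 < gamma ->
  (forall C, compact C -> connected C ->
    (exists x y, [/\ C x, C y & x <> y]) ->
    exists g : G, (delta%:E < diam (phi g @` C))%E) ->
  exists2 N, (0 < N)%N & forall C, connected C ->
    (exists x y, [/\ C x, C y & gamma <= mdist x y]) ->
    exists g x y, [/\ (word_length K g <= N)%N, C x, C y &
                      delta < mdist (phi g x) (phi g y)].
Proof.
move=> Mc phic gamma0 cw; apply: contrapT => noN.
have /choice[C CP] : forall n, exists C, [/\ connected C,
    exists x y, [/\ C x, C y & gamma <= mdist x y] &
    forall g x y, (word_length K g <= n.+1)%N -> C x -> C y ->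
      mdist (phi g x) (phi g y) <= delta].
  move=> n; apply: contrapT => noC; apply: noN; exists n.+1 => // C Cc Cxy.
  apply: contrapT => nog; apply: noC; exists C; split=> // g x y gn Cx Cy.
  by rewrite leNgt; apply/negP => far; apply: nog; exists g, x, y.
have [U UU ooU] := ultra_eventually.
have /choice[xy xyP] : forall n, exists xy : M * M,
    [/\ C n xy.1, C n xy.2 & gamma <= mdist xy.1 xy.2].
  by move=> n; have [_ [x [y ?]] _] := CP n; exists (x, y).
have [x xx] := compact_ultra_cvg (fst \o xy) Mc.
have [y yy] := compact_ultra_cvg (snd \o xy) Mc.
pose L := ultralimit U C.
have Lcl : closed L by exact: ultralimit_closed.
have Lx : L x by apply: ultralimit_cvg xx; apply: nearW => n; case: (xyP n).
have Ly : L y by apply: ultralimit_cvg yy; apply: nearW => n; case: (xyP n).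
have xy_ge : gamma <= mdist x y.
  by apply: (cvg_mdist_ge xx yy); apply: nearW => n; case: (xyP n).
have Lc : connected L.
  apply: (@ultralimit_connected _ _ _ _ _ (fun n => n.+1%:R^-1)) => //.
    by move=> s s0; apply: ooU; exact: (near_infty_natSinv_lt (PosNum s0)).
  by apply: nearW => n; apply: connected_chained; [rewrite invr_gt0|case: (CP n)].
have [|g /diam_gtP[_ [_ [[u Lu <-] [v Lv <-]]]]] :=
    cw L (subclosed_compact Lcl Mc (@subsetT _ _)) Lc.
  by exists x, y; split=> // xy_eq; move: xy_ge; rewrite xy_eq mdistxx leNgt gamma0.
rewrite ltNge => /negP; apply; apply: ultralimit_mdist_le Lu Lv; first exact: phic.
apply: ooU; exists (word_length K g) => // n /= gn u' v'.
by have [_ _ small] := CP n; apply: small; exact: leqW.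
Qed.

(** One round of the construction: stretch [C] by [g], split the image into two
    far apart wide continua, take separated sets in both by induction and pull
    them back by [g^-1].  Points from different halves are separated by [g];
    points from the same half are separated by [h * g], where [h] separates
    their images under [g]. *)
Lemma separated_doubling phi K delta N : compact [set: M] ->
  continuous_action phi -> generating_set K -> 0 < delta ->
  (forall C, connected C ->
    (exists x y, [/\ C x, C y & delta / 3 <= mdist x y]) ->
    exists g x y, [/\ (word_length K g <= N)%N, C x, C y &
                      delta < mdist (phi g x) (phi g y)]) ->
  forall k C, closed C -> connected C ->
    (exists x y, [/\ C x, C y & delta / 3 <= mdist x y]) ->
    exists A : {fset M}, [/\ [set` A] `<=` C, #|` A|%fset = (2 ^ k)%N &
      separated_fset phi K (k * N) (delta / 3) A].
Proof.
move=> Mc [phi1 phiM phic] Kgen delta0 wide.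
elim=> [|k IHk] C Ccl Cc Cxy.
  have [x [_ [Cx _ _]]] := Cxy; exists [fset x]%fset; split.
  - by move=> _ /= /fset1P ->.
  - by rewrite cardfs1.
  - by move=> _ _ /fset1P -> /fset1P ->.
have [g [x [y [gN Cx Cy far]]]] := wide C Cc Cxy.
have phigK : cancel (phi g) (phi (g^-1)%g) by move=> z; rewrite -phiM mulVg phi1.
have phigVK : cancel (phi (g^-1)%g) (phi g) by move=> z; rewrite -phiM mulgV phi1.
pose C' := phi g @` C.
have [C'cl C'c] := continuum_image Mc (phic g) Ccl Cc.
(* the two halves of radius [r] and the gap between them make up [delta] *)
pose r := delta / 3.
have r3 : delta = r + r + r by rewrite /r; lra.
have r0 : 0 < r by rewrite divr_gt0.
have r_le : 0 <= r <= mdist (phi g x) (phi g y).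
  by rewrite (ltW r0) (le_trans _ (ltW far))// r3 -addrA lerDl addr_ge0 ?ltW.
have C'x : C' (phi g x) by exists x.
have C'y : C' (phi g y) by exists y.
have half (D : set M) z : D z -> (exists2 w, D w & r <= mdist z w) ->
    exists x y, [/\ D x, D y & r <= mdist x y].
  by move=> Dz [w Dw zw]; exists z, w.
have [D0 [D0cl D0c D0C D0x D0w]] := boundary_bumping Mc C'cl C'c C'x C'y r_le.
rewrite metric_sym in r_le.
have [D1 [D1cl D1c D1C D1y D1w]] := boundary_bumping Mc C'cl C'c C'y C'x r_le.
have D01 u v : D0 u -> D1 v -> r < mdist u v.
  move=> /D0C[_ /= xu] /D1C[_ /= yv]; rewrite ltNge; apply/negP => uv.
  move: far; rewrite ltNge => /negP; apply.
  rewrite (le_trans (metric_triangle (phi g x) u (phi g y)))// r3 -addrA lerD//.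
  by rewrite (le_trans (metric_triangle u v (phi g y)))// lerD// metric_sym.
have [A0 [A0D cA0 sA0]] := IHk D0 D0cl D0c (half D0 _ D0x D0w).
have [A1 [A1D cA1 sA1]] := IHk D1 D1cl D1c (half D1 _ D1y D1w).
have dis : [disjoint A0 & A1]%fset.
  apply/fdisjointP => z /A0D D0z; apply/negP => /A1D /(D01 _ _ D0z).
  by rewrite mdistxx ltNge (ltW r0).
have glue h u v : (word_length K h <= k * N)%N ->
    r < mdist (phi h u) (phi h v) ->
    separated_points phi K (k.+1 * N) r (phi (g^-1)%g u) (phi (g^-1)%g v).
  move=> hk uv; exists (h * g)%g; last by rewrite !phiM !phigVK.
  by rewrite (leq_trans (word_length_mul _ _ Kgen))// mulSn addnC leq_add.
have cross u v : r < mdist u v ->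
    separated_points phi K (k.+1 * N) r (phi (g^-1)%g u) (phi (g^-1)%g v).
  move=> uv; exists g; last by rewrite !phigVK.
  by rewrite (leq_trans gN)// mulSn leq_addr.
exists [fset phi (g^-1)%g z | z in (A0 `|` A1)%fset]%fset; split.
- move=> _ /= /imfsetP[z /= + ->]; rewrite in_fsetU => /orP[/A0D/D0C|/A1D/D1C].
    by move=> [[w Cw <-] _]; rewrite phigK.
  by move=> [[w Cw <-] _]; rewrite phigK.
- rewrite card_imfset//=; last exact: can_inj phigVK.
  by have [_] := leq_card_fsetU A0 A1; rewrite dis cA0 cA1 addnn -mul2n -expnS => /eqP.
- move=> _ _ /imfsetP[u /= + ->] /imfsetP[v /= + ->].
  rewrite !in_fsetU => /orP[Au|Au] /orP[Av|Av] uv.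
  + have [|h hk huv] := sA0 u v Au Av; first by move=> uv'; apply: uv; rewrite uv'.
    exact: glue huv.
  + by apply/cross/D01; [exact: A0D|exact: A1D].
  + by apply/cross; rewrite metric_sym; apply/D01; [exact: A0D|exact: A1D].
  + have [|h hk huv] := sA1 u v Au Av; first by move=> uv'; apply: uv; rewrite uv'.
    exact: glue huv.
Qed.

End Action.

(** * Lower bounds on entropy *)

Section LimSup.
Context {R : realType}.
Implicit Types (u v : nat -> \bar R).

Lemma limn_esup_ge_freq u (c : \bar R) :
  (forall m, exists2 n, (m <= n)%N & (c <= u n)%E) -> (c <= limn_esup u)%E.
Proof.
move=> cu; apply: le_ereal_inf_tmp => _ [V [m _ mV] <-].
have [n mn cun] := cu m; apply: le_ereal_sup_tmp; exists (u n) => //.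
by exists n => //; exact: mV.
Qed.

Lemma le_limn_esup u v : (forall n, (u n <= v n)%E) ->
  (limn_esup u <= limn_esup v)%E.
Proof.
move=> uv; apply: le_ereal_inf_tmp => _ [V ooV <-].
apply: (@le_trans _ _ (ereal_sup (u @` V))).
  by apply: ereal_inf_lbound; exists V.
apply: ge_ereal_sup => _ [n Vn <-]; apply: le_ereal_sup_tmp.
by exists (v n) => //; exists n.
Qed.

End LimSup.

Section Entropy.
Context {R : realType} {G : groupType} {M : metricType R}.
Context (phi : G -> M -> M) (K : {fset G}).
Implicit Types (e : R) (n N : nat).

Lemma max_separated_ge n e (A : {fset M}) : separated_fset phi K n e A ->
  ((#|` A|%fset%:R)%:E <= max_separated phi K n e)%E.
Proof. by move=> Asep; apply: ereal_sup_ubound; exists A. Qed.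

Lemma max_separated_ge0 n e : (0 <= max_separated phi K n e)%E.
Proof.
have sep0 : separated_fset phi K n e fset0 by move=> x y; rewrite in_fset0.
by apply: le_trans (max_separated_ge sep0); rewrite cardfs0.
Qed.

Lemma max_separated_anti n e e' : e <= e' ->
  (max_separated phi K n e' <= max_separated phi K n e)%E.
Proof.
move=> ee'; apply: ge_ereal_sup => _ [A Asep <-].
apply: max_separated_ge => x y Ax Ay xy.
by have [g gn far] := Asep x y Ax Ay xy; exists g => //; exact: le_lt_trans far.
Qed.

Definition entropy_at e := 
  limn_esup (fun n => (n%:R^-1)%:E * lne (max_separated phi K n e))%E.

Lemma entropy_at_anti e e' : e <= e' -> (entropy_at e' <= entropy_at e)%E.
Proof.
move=> ee'; apply: le_limn_esup => n; apply: lee_wpmul2l.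
  by rewrite lee_fin invr_ge0.
rewrite lee_lne ?in_itv/= ?leey ?max_separated_ge0//.
exact: max_separated_anti.
Qed.

(** Monotonicity in the scale ensures both that the limit defining the entropy
    exists and that each scale gives a lower bound for it. *)
Lemma geometric_entropy_ge e : 0 < e ->
  (entropy_at e <= geometric_entropy phi K)%E.
Proof.
move=> e0; apply: lime_ge.
  apply: nonincreasing_at_right_is_cvge; near=> b => a c _ _ ac.
  exact: entropy_at_anti.
by near=> a; apply: entropy_at_anti; near: a; exact: nbhs_right_le.
Unshelve. all: by end_near. Qed.

Lemma entropy_at_ge e N : (0 < N)%N ->
  (forall k, exists2 A : {fset M}, #|` A|%fset = (2 ^ k)%N &
     separated_fset phi K (k * N) e A) ->
  ((ln 2 / N%:R)%:E <= entropy_at e)%E.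
Proof.
move=> N0 sep; apply: limn_esup_ge_freq => m; exists (m.+1 * N)%N.
  by rewrite (leq_trans (leqnSn m))// leq_pmulr.
have [A cA Asep] := sep m.+1.
have -> : ln 2 / N%:R = (m.+1 * N)%:R^-1 * ln (2 ^+ m.+1) :> R.
  rewrite lnXn// -[ln 2 *+ _]mulr_natl natrM invfM -mulrA mulrCA mulKf//.
  by rewrite mulrC.
rewrite EFinM; apply: lee_wpmul2l; first by rewrite lee_fin invr_ge0.
rewrite -lne_EFin ?exprn_gt0// lee_lne ?in_itv/= ?leey ?max_separated_ge0//.
  by rewrite -natrX -cA; exact: max_separated_ge.
by rewrite andbT lee_fin exprn_ge0.
Qed.

End Entropy.

Theorem corollary6 (R : realType) (G : groupType) (M : metricType R)
    (phi : G -> M -> M)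
    (M_infinite : infinite_set [set: M])
    (M_compact : compact [set: M])
    (M_locally_connected : locally_connected M)
    (G_fg : finitely_generated G)
    (phi_action : continuous_action phi)
    (phi_cw : cw_expansive phi) :
  positive_geometric_entropy phi.
Proof.
move=> K Kgen; have [delta delta0 cw] := phi_cw; have [_ _ phic] := phi_action.
have r0 : 0 < delta / 3 by rewrite divr_gt0.
have [N N0 wide] := cw_expansive_uniform K M_compact phic r0 cw.
have [C [Ccl Cc Cxy]] :=
  locally_connected_nontrivial M_compact M_infinite M_locally_connected.
(* [C] itself may be narrower than [delta / 3]: stretch it once to start *)
have [g /diam_gtP[x [y [Cx Cy xy]]]] :=
  cw C (subclosed_compact Ccl M_compact (@subsetT _ _)) Cc Cxy.
have [D [Dcl Dc Dxy]] : exists D : set M, [/\ closed D, connected D &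
    exists x y, [/\ D x, D y & delta / 3 <= mdist x y]].
  have [gCcl gCc] := continuum_image M_compact (phic g) Ccl Cc.
  exists (phi g @` C); split=> //; exists x, y; split=> //.
  by rewrite (le_trans _ (ltW xy))// ler_pdivrMr// ler_peMr ?ler1n// ltW.
apply: lt_le_trans (geometric_entropy_ge phi K r0).
apply: lt_le_trans (entropy_at_ge N0 _).
  by rewrite lte_fin divr_gt0 ?ltr0n// ln_gt0// ltr1n.
move=> k; have [A [_ cA Asep]] :=
  separated_doubling M_compact phi_action Kgen delta0 wide k Dcl Dc Dxy.
by exists A.
Qed.
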